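(* There exists a closed set $E\subset\mathbb{R}$ whose complement has finite Lebesgue measure such that for every $p\in\mathbb{R}$ and every $r_0>0$, $$\sum_{n=1}^{\infty}\int_{(E-p)^c\cap[0,r_0^n]}\frac1n x^{\frac1n-1}\,d\lambda(x)=\infty .$$
   Context: $\lambda$ denotes Lebesgue measure on $\mathbb{R}$; $E-p=\{x-p:x\in E\}$ and $(E-p)^c=\mathbb{R}\setminus(E-p)$. *)

(* Defs.v *)
From mathcomp Require Import all_boot all_order all_algebra.
From mathcomp Require Import all_classical all_reals all_analysis.

(* Main.v *)
Require Import Defs.
From mathcomp Require Import all_boot all_order all_algebra.
From mathcomp Require Import all_classical all_reals all_analysis.
From mathcomp Require Import measurable_realfun ring lra.
Import Order.TTheory GRing.Theory Num.Theory.
Import numFieldNormedType.Exports.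
Local Open Scope classical_set_scope.
Local Open Scope ring_scope.

(** Under the substitution [x = t ^+ n] the [n]-th integrand becomes the constant
    [1], so its integral over the whole of [[0, r ^+ n]] is [r].  If the open set
    [U], the complement of [E], fills a fixed proportion [d] of each interval
    [[p, p + r ^+ n]], then the series at [p] diverges at least as fast as the
    harmonic series: the integrand is nonincreasing, so on a subset of
    [[0, r ^+ n]] of measure at least [d * r ^+ n] its integral is at least
    [d * r ^+ n] times its value at [r ^+ n], which is [d * r / n]
    ([integral_power_ge]).

    A set of finite measure cannot have a fixed density everywhere, so [U] is a
    union of combs, the [j]-th being a periodic set of small density [tooth j]
    cut down to [`]-(j+1), j+1[].  The densities make the total measure finite
    ([measure_bigcup_combs]).  They also determine, by divergence of the harmonic
    series, a number [K j] of terms for which the harmonic sum is at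
    least [4 (j+1) / tooth j].  The period is then chosen so fine that the comb looks
    uniform in every interval of length at least [(j+1) ^- K j]
    ([combs_density]).  Given [p] and [r0], put [r = min r0 1]; for every large
    [j] the first [K j] terms of the series already sum to at least [(j+1) r],
    so the series is infinite.  A single comb is used for each such bound, so
    overlaps between the combs do not matter. *)

(** * Periodic combs *)

Section Comb.
Context {R : realType}.
Implicit Types (q h e s r d : R) (k : int) (A : set R).
Local Notation mu := (@lebesgue_measure R).

(** [e] is the proportion of each period that is covered, for [0 <= e <= 1]. *)
Definition comb q h e : set R :=
  \bigcup_k `]q + k%:~R * h, q + (k%:~R + e) * h[%classic.

Lemma open_comb q h e : open (comb q h e).
Proof. by apply: bigcup_open => k _; exact: itv_open. Qed.

Lemma comb_shift q p h e x : comb q h e (x + p) <-> comb (q - p) h e x.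
Proof.
by split=> -[k _]; rewrite /= in_itv /= => /andP[? ?]; exists k => //=;
  rewrite in_itv /=; apply/andP; split; lra.
Qed.

Lemma comb_period q h e k : 0 < h -> e <= 1 ->
  comb q h e `&` `[q + k%:~R * h, q + (k + 1)%:~R * h[ =
  `]q + k%:~R * h, q + (k%:~R + e) * h[%classic.
Proof.
move=> h0 e1; apply/seteqP; split=> [x [[k' _] /=]|x /=].
  rewrite !in_itv /= => /andP[k'x xk'] /andP[kx xk].
  suff -> : k = k' by rewrite k'x xk'.
  (* two teeth indices meeting the same period differ by less than 1 *)
  apply/eqP; rewrite eq_le -!ltzD1 -!(ltr_int R) -(ltr_pM2r h0).
  rewrite -[X in _ && X](ltr_pM2r h0).
  apply/andP; split; last lra.
  have : (k'%:~R + e) * h <= (k' + 1)%:~R * h.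
    by rewrite ler_pM2r// intrD lerD2l.
  lra.
rewrite !in_itv /= => /andP[kx xk]; split.
  by exists k => //=; rewrite in_itv /= kx xk.
have : (k%:~R + e) * h <= (k + 1)%:~R * h by rewrite ler_pM2r// intrD lerD2l.
by move=> xk'; apply/andP; split; lra.
Qed.

(** An exact count over consecutive periods serves twice: it bounds the measure of
    a truncated comb from above and its measure in a short interval from below. *)
Lemma comb_periods q h e k (m : nat) : 0 < h -> 0 <= e <= 1 ->
  mu (comb q h e `&` `[q + k%:~R * h, q + (k + m%:Z)%:~R * h[) =
  (m%:R * (e * h))%:E.
Proof.
move=> h0 /andP[e0 e1]; elim: m => [|m IH].
  by rewrite addr0 set_itvco0 setI0 measure0 mul0r.
have mC := open_measurable (open_comb q h e).
have le1 : k%:~R * h <= (k + m%:Z)%:~R * h.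
  by rewrite ler_pM2r// ler_int lerDl.
have le2 : (k + m%:Z)%:~R * h <= (k + m%:Z + 1)%:~R * h.
  by rewrite ler_pM2r// ler_int lerDl.
have -> : (k + m.+1%:Z) = (k + m%:Z + 1) by rewrite -addn1 PoszD addrA.
rewrite (_ : `[_, q + (k + m%:Z + 1)%:~R * h[%classic =
   `[q + k%:~R * h, q + (k + m%:Z)%:~R * h[ `|`
   `[q + (k + m%:Z)%:~R * h, q + (k + m%:Z + 1)%:~R * h[); last first.
  apply/seteqP; split=> x /=; rewrite !in_itv /=.
    by move=> /andP[-> ->]; case: ltP => // _; [left|right].
  by move=> [|] /andP[? ?]; apply/andP; split; lra.
rewrite setIUr measureU; [|exact: measurableI|exact: measurableI|].
  transitivity ((m%:R * (e * h))%:E +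
      mu `](q + (k + m%:Z)%:~R * h)%R, (q + ((k + m%:Z)%:~R + e) * h)%R[)%E.
    by apply: (f_equal2 adde IH); rewrite comb_period.
  rewrite lebesgue_measure_itv /= lte_fin.
  (* for [e = 0] the tooth is empty and both sides vanish *)
  case: ifPn => [_|le3].
    by rewrite -EFinB -EFinD; congr EFin; rewrite -[m.+1]addn1 natrD; ring.
  have eh0 : 0 <= e * h by rewrite mulr_ge0// ltW.
  rewrite adde0 -[m.+1]addn1 natrD; congr EFin.
  suff -> : e * h = 0 by rewrite !mulr0.
  by apply/eqP; rewrite eq_le eh0 andbT; move: le3; rewrite -leNgt; lra.
rewrite -subset0 => x /= [[_ +] [_]]; rewrite !in_itv /= => /andP[_ +] /andP[+ _].
by move=> a b; have := lt_le_trans a b; rewrite ltxx.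
Qed.

(** An interval of length [s] contains at least [s / (4 h)] full periods when
    [4 h <= s], wherever the comb is positioned. *)
Lemma comb_density q h e s : 0 < h -> 0 <= e <= 1 -> 4 * h <= s ->
  ((e / 4 * s)%:E <= mu (comb q h e `&` `]0%R, s]))%E.
Proof.
move=> h0 e01 hs.
have h0' := lt0r_neq0 h0.
(* [q + k h] is the first period boundary after 0; the [m] periods that follow
   fill at most half of the interval, which leaves room for the initial offset *)
pose k := Num.floor (- q / h) + 1; pose m := Num.truncn (s / (2 * h)).
have /andP[kl kr] : 0 < q + k%:~R * h <= h.
  have := floor_itv (- q / h); rewrite -/k => /andP[].
  rewrite ler_pdivlMr// ltr_pdivrMr// => a b.
  have : k%:~R * h = (Num.floor (- q / h))%:~R * h + h.
    by rewrite /k intrD mulrDl mul1r.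
  by move=> kE; apply/andP; split; lra.
have /andP[ml mr] : m%:R * (2 * h) <= s < m.+1%:R * (2 * h).
  have s0 : 0 <= s / (2 * h) by rewrite divr_ge0//; lra.
  have h20 : 0 < 2 * h by lra.
  have := truncn_itv s0; rewrite -/m => /andP[].
  by rewrite ler_pdivlMr// ltr_pdivrMr// => -> ->.
have kmE : (k + m%:Z)%:~R * h = k%:~R * h + m%:R * h by rewrite intrD mulrDl.
apply: (@le_trans _ _ (mu (comb q h e `&`
    `[q + k%:~R * h, q + (k + m%:Z)%:~R * h[))).
  rewrite comb_periods// lee_fin.
  have -> : m%:R * (e * h) = e * (m%:R * h) by ring.
  rewrite -mulrA; case/andP: e01 => e0 _; apply: ler_wpM2l => //.
  move: mr; rewrite -[m.+1]addn1 natrD; lra.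
have mC := open_measurable (open_comb q h e).
apply: le_measure; rewrite ?inE; [exact: measurableI|exact: measurableI|].
apply: setIS => x /=; rewrite !in_itv /= kmE => /andP[? ?].
by apply/andP; split; lra.
Qed.

(** * Integral bound and harmonic sums *)

(** The integrand is at least its value at [r ^+ n], and
    [r ^+ n * (r ^+ n) `^ (n%:R^-1 - 1) = r].  The half-open interval avoids the
    point [0], where the convention [0 `^ a = 0] for nonzero [a] breaks
    monotonicity. *)
Lemma integral_power_ge A r r0 d (n : nat) : measurable A -> (0 < n)%N ->
  0 < r <= r0 -> 0 <= d ->
  ((d * r ^+ n)%:E <= mu (A `&` `]0%R, (r ^+ n)%R]))%E ->
  ((d * r * n%:R^-1)%:E <= \int[mu]_(x in A `&` `[0%R, (r0 ^+ n)%R])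
     (n%:R^-1 * x `^ (n%:R^-1 - 1))%:E)%E.
Proof.
move=> mA n0 /andP[rgt0 rr0] d0 dA.
have rn0 : 0 < r ^+ n by rewrite exprn_gt0.
have nr0 : (0 : R) < n%:R by rewrite ltr0n.
have ni0 : (0 : R) < n%:R^-1 by rewrite invr_gt0.
have mf (D : set R) : measurable_fun D
    (fun x : R => (n%:R^-1 * x `^ (n%:R^-1 - 1))%:E).
  apply/measurable_EFinP; apply: measurable_funM => //.
  exact: measurable_funS (measurable_powR _).
have f0 (x : R) : (0 <= (n%:R^-1 * x `^ (n%:R^-1 - 1))%:E)%E.
  by rewrite lee_fin mulr_ge0 ?powR_ge0// ltW.
have mAr : measurable (A `&` `]0%R, (r ^+ n)%R]) by exact: measurableI.
apply: (@le_trans _ _ (\int[mu]_(x in A `&` `]0%R, (r ^+ n)%R])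
     (n%:R^-1 * x `^ (n%:R^-1 - 1))%:E)%E); last first.
  apply: ge0_subset_integral => //; [exact: measurableI|exact: mf|].
  apply: setIS => x /=; rewrite !in_itv /= => /andP[x0 xr].
  rewrite (ltW x0) (le_trans xr)//.
  by rewrite lerXn2r// nnegrE ?(ltW rgt0)// (le_trans (ltW rgt0)).
pose c := n%:R^-1 * (r ^+ n) `^ (n%:R^-1 - 1).
have c0 : 0 <= c by rewrite mulr_ge0 ?powR_ge0// ltW.
apply: (@le_trans _ _ (\int[mu]_(x in A `&` `]0%R, (r ^+ n)%R]) cst c%:E x)%E);
  last first.
  apply: ge0_le_integral.
  - exact: mAr.
  - by move=> x _; rewrite lee_fin.
  - exact: measurable_cst.
  - exact: mf.
  move=> x [_ /=]; rewrite in_itv /= => /andP[x0 xr].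
  rewrite lee_fin ler_wpM2l// ?(ltW ni0)//.
  (* the exponent is nonpositive, so the integrand is nonincreasing *)
  have -> : n%:R^-1 - 1 = - (1 - n%:R^-1) :> R by rewrite opprB.
  rewrite !powRN lef_pV2 ?posrE ?powR_gt0//.
  apply: ge0_ler_powR; rewrite ?nnegrE ?(ltW x0) ?(ltW rn0)//.
  by rewrite subr_ge0 invf_le1// ler1n.
rewrite integral_cst//.
apply: le_trans (lee_wpmul2l _ dA); rewrite ?lee_fin//.
suff -> : d * r * n%:R^-1 = c * (d * r ^+ n) by [].
have rE : r ^+ n * (r ^+ n) `^ (n%:R^-1 - 1) = r.
  rewrite mulr_powRB1 ?(ltW rn0)// -powR_mulrn ?(ltW rgt0)// -powRrM.
  by rewrite mulfV ?gt_eqF// powRr1// ltW.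
by rewrite /c -{1}rE; ring.
Qed.

Lemma harmonic_unbounded (M : R) :
  exists K : nat, M <= \sum_(1 <= n < K.+1) n%:R^-1.
Proof.
have nd : {homo series (@harmonic R) : n m / (n <= m)%N >-> n <= m}.
  apply/nondecreasing_seqP => n; rewrite seriesSr lerDl.
  exact: harmonic_ge0.
have /cvgryPge/(_ M)[K _ /(_ K (leqnn K)) MK] :=
  nondecreasing_dvgn_lt nd (@dvg_harmonic R).
exists K; apply: le_trans MK _.
by rewrite /series /= big_add1.
Qed.

End Comb.

(** * The union of the combs *)

Section CombUnion.
Context {R : realType}.
Implicit Types (p r : R) (j n : nat).
Local Notation mu := (@lebesgue_measure R).

(** The comb of index [j] lives on an interval of length [2 (j+1)], so this
    density gives it measure at most [2 / 2 ^ (j+1)]. *)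
Definition tooth j : R := (j.+1%:R * 2 ^+ j.+1)^-1.

Context (K : nat -> nat).

(** The number of teeth per unit length, so that four periods have length
    [(j+1) ^- K j]; being an integer, it makes the endpoints of
    [`]-(j+1), j+1[] period boundaries. *)
Definition teeth_number j : nat := 4 * j.+1 ^ K j.

Definition combs j : set R :=
  comb 0 (teeth_number j)%:R^-1 (tooth j) `&` `]- j.+1%:R, j.+1%:R[%classic.

Lemma tooth_itv j : 0 <= tooth j <= 1.
Proof.
rewrite /tooth invr_ge0 mulr_ge0 ?ler0n ?exprn_ge0//=.
rewrite invf_le1 ?mulr_gt0 ?ltr0n ?exprn_gt0//.
by rewrite mulr_ege1 ?ler1n// exprn_ege1// ler1n.
Qed.

Lemma open_combs j : open (combs j).
Proof. by apply: openI; [exact: open_comb|exact: itv_open]. Qed.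

Lemma teeth_number_gt0 j : 0 < (teeth_number j)%:R :> R.
Proof. by rewrite ltr0n muln_gt0 expn_gt0. Qed.

Lemma measure_combs j : (mu (combs j) <= (2 / (2 ^ j.+1)%:R)%:E)%E.
Proof.
set N := teeth_number j; set m := (2 * (j.+1 * N))%N.
have N0 := teeth_number_gt0 j; rewrite -/N in N0.
have h0 : 0 < N%:R^-1 :> R by rewrite invr_gt0.
have jE : (j.+1 * N)%:R / N%:R = j.+1%:R :> R by rewrite natrM mulfK ?gt_eqF.
have := @comb_periods R 0 N%:R^-1 (tooth j) (- (j.+1 * N)%:Z) m h0 (tooth_itv j).
rewrite !add0r.
have -> : (- (j.+1 * N)%:Z)%:~R / N%:R = - j.+1%:R :> R.
  by rewrite mulrNz mulNr jE.
have -> : (- (j.+1 * N)%:Z + m%:Z)%:~R / N%:R = j.+1%:R :> R.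
  by rewrite /m mul2n -addnn PoszD addKr.
have -> : m%:R * (tooth j / N%:R) = 2 / (2 ^ j.+1)%:R :> R.
  transitivity (2 * (tooth j * ((j.+1 * N)%:R / N%:R))).
    by rewrite /m natrM; ring.
  by rewrite jE /tooth invfM mulrAC mulVf ?pnatr_eq0// mul1r natrX.
move=> <-; have mC := open_measurable (open_comb 0 N%:R^-1 (tooth j)).
apply: le_measure; rewrite ?inE.
- exact: open_measurable (open_combs j).
- exact: measurableI.
- by apply: setIS => x /=; rewrite !in_itv /= => /andP[/ltW -> ->].
Qed.

Lemma measure_bigcup_combs : (mu (\bigcup_j combs j) < +oo)%E.
Proof.
have mU : measurable (\bigcup_j combs j).
  by apply: open_measurable; apply: bigcup_open => j _; exact: open_combs.
apply: (@le_lt_trans _ _ (\sum_(0 <= j <oo) (2 / (2 ^ j.+1)%:R)%:E)%E).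
  apply: (@le_trans _ _ (\sum_(0 <= j <oo) mu (combs j))%E).
    apply: generalized_Boole_inequality => // j.
    exact: open_measurable (open_combs j).
  by apply: lee_nneseries => j _ //; exact: measure_combs.
by apply: le_lt_trans (epsilon_trick0 _ _) (ltry 2).
Qed.

(** For [n <= K j] and [r >= 1 / (j+1)] the length [r ^+ n] is at least four
    periods of the comb of index [j], and [`]p, p + 1]] lies in the interval to
    which that comb is cut down. *)
Lemma combs_density j n p r : (0 < n <= K j)%N -> j.+1%:R^-1 <= r <= 1 ->
  `|p| + 1 < j.+1%:R ->
  ((tooth j / 4 * r ^+ n)%:E <=
    mu ((fun x => x + p)%R @^-1` (\bigcup_i combs i) `&` `]0%R, (r ^+ n)%R]))%E.
Proof.
move=> /andP[n0 nK] /andP[jr r1] pj.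
have ji0 : 0 < j.+1%:R^-1 :> R by rewrite invr_gt0.
have rn1 : r ^+ n <= 1 by rewrite exprn_ile1// (le_trans (ltW ji0)).
have h4 : 4 * (teeth_number j)%:R^-1 <= r ^+ n.
  rewrite /teeth_number natrM natrX invfM mulVKf ?pnatr_eq0// -exprVn.
  apply: (@le_trans _ _ (j.+1%:R^-1 ^+ n)).
    by rewrite ler_wiXn2l// ?(ltW ji0)// invf_le1 ?ler1n.
  by rewrite lerXn2r// nnegrE ?(ltW ji0)// (le_trans (ltW ji0)).
have h0 : 0 < (teeth_number j)%:R^-1 :> R by rewrite invr_gt0 teeth_number_gt0.
apply: (@le_trans _ _ (mu (comb (0 - p)%R (teeth_number j)%:R^-1%R (tooth j) `&`
    `]0%R, (r ^+ n)%R]))%E).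
  exact: comb_density h0 (tooth_itv j) h4.
have oC : open (comb (0 - p) (teeth_number j)%:R^-1 (tooth j)) by exact: open_comb.
apply: le_measure; rewrite ?inE.
- by apply: measurableI => //; exact: open_measurable.
- apply: measurableI => //; apply: open_measurable.
  apply: open_comp; last by apply: bigcup_open => i _; exact: open_combs.
  by move=> x _; apply: cvgD; [exact: cvg_id|exact: cvg_cst].
move=> x [cx xr]; split => //; exists j => //; split.
  exact/comb_shift.
move: xr; rewrite /= !in_itv /= => /andP[x0 xr].
have := ler_norm p; have := ler_norm (- p); rewrite normrN => *.
by apply/andP; split; lra.
Qed.

End CombUnion.

Local Open Scope ereal_scope.

Theorem mainTheorem6 (R : realType) :
  exists E : set R,
    [/\ closed E,
        lebesgue_measure (~` E) < +oo
      & forall p r0 : R, (0 < r0)%R ->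
          \sum_(1 <= n <oo)
             \int[lebesgue_measure]_(x in ~` [set (x - p)%R | x in E] `&` `[0%R, (r0 ^+ n)%R])
               (n%:R^-1 * x `^ (n%:R^-1 - 1))%:E = +oo].
Proof.
have /choice[K HK] : forall j, exists K : nat,
    (4 * j.+1%:R / tooth j <= \sum_(1 <= n < K.+1) n%:R^-1 :> R)%R.
  by move=> j; exact: harmonic_unbounded.
pose U : set R := \bigcup_j combs K j.
have oU : open U by apply: bigcup_open => j _; exact: open_combs.
exists (~` U); split.
- exact: open_closedC.
- by rewrite setCK; exact: measure_bigcup_combs.
move=> p r0 r0gt0.
have -> : ~` [set (x - p)%R | x in ~` U] = (fun x => x + p)%R @^-1` U.
  apply/seteqP; split=> x /=.
    by move=> nx; apply: contrapT => Ux; apply: nx; exists (x + p)%R; rewrite ?addrK.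
  by move=> Ux [y nUy xE]; apply: nUy; move: Ux; rewrite -xE subrK.
have oUp : open ((fun x => x + p)%R @^-1` U).
  apply: open_comp => // x _.
  by apply: cvgD; [exact: cvg_id|exact: cvg_cst].
pose r := Num.min r0 1%R.
have rgt0 : (0 < r)%R by rewrite lt_min r0gt0 ltr01.
have r1 : (r <= 1)%R by rewrite ge_min lexx orbT.
have rr0 : (0 < r <= r0)%R by rewrite rgt0 ge_min lexx.
apply: eq_infty => M.
(* large enough for [p] to lie well inside the comb, for [r >= 1 / (j+1)] and for
   [(j+1) r >= M] *)
pose j := Num.truncn (`|p| + 1 + r^-1 + `|M| / r).
have jgt : (`|p| + 1 + r^-1 + `|M| / r < j.+1%:R)%R by exact: truncnS_gt.
have ri0 : (0 < r^-1)%R by rewrite invr_gt0.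
have Mr0 : (0 <= `|M| / r)%R by rewrite divr_ge0// ltW.
have p0 := normr_ge0 p.
have pj : (`|p| + 1 < j.+1%:R)%R by lra.
have jr : (j.+1%:R^-1 <= r <= 1)%R.
  rewrite r1 andbT -[leRHS]invrK lef_pV2 ?posrE//; lra.
have Mj : (M <= j.+1%:R * r)%R.
  apply: le_trans (ler_norm M) _; rewrite -ler_pdivrMr//; lra.
have t0 : (0 < @tooth R j)%R.
  by rewrite invr_gt0 mulr_gt0// exprn_gt0.
have int_ge0 n : 0 <= \int[@lebesgue_measure R]_(x in
    (fun x => x + p)%R @^-1` U `&` `[0%R, (r0 ^+ n)%R])
    (n%:R^-1 * x `^ (n%:R^-1 - 1))%:E.
  apply: integral_ge0 => x _.
  by rewrite lee_fin mulr_ge0 ?powR_ge0// invr_ge0.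
apply: le_trans (nneseries_lim_ge (K j).+1 _); last by move=> n _ _; exact: int_ge0.
apply: (@le_trans _ _ (\sum_(1 <= n < (K j).+1)
    (tooth j / 4 * r * n%:R^-1)%:E)); last first.
  rewrite big_nat_cond [leRHS]big_nat_cond; apply: lee_sum => n.
  rewrite andbT ltnS => nK; apply: integral_power_ge => //.
  - exact: open_measurable.
  - by case/andP: nK.
  - by rewrite divr_ge0// ltW.
  - exact: combs_density.
rewrite sumEFin lee_fin -mulr_sumr.
apply: (le_trans Mj).
have c0 : (0 <= tooth j / 4 * r)%R by rewrite mulr_ge0 ?divr_ge0 ?ltW.
apply: le_trans (ler_wpM2l c0 (HK j)).
rewrite le_eqVlt; apply/orP; left; apply/eqP; field.
by rewrite gt_eqF.
Qed.
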